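(* Let $i,j$ be positive integers. Then $(i,j,1,1)\in\mathcal{A}_{\mathbb{Q}}$ if and only if at least one of the following holds (congruences being taken componentwise): (a) $i=j$ and $i\not\equiv 0\pmod 4$; (b) $(i,j)\equiv(1,1)\pmod 2$; (c) $(i,j)$ is congruent modulo $6$ to one of $(1,2),(2,1),(4,5),(5,4)$.
   Context: All rings are associative and unital and all homomorphisms are unital. For a commutative ring $A$ and positive integers $i,j$, $R(A;i,j,1,1)$ is the quotient of the free (noncommutative) $A$-algebra $A\langle x,y\rangle$ by the two-sided ideal generated by $x^iy+yx^j-1$ and $y^2$. For a field $k$, $(i,j,1,1)\in\mathcal{A}_k$ means that there is a non-trivial homomorphism $R(k;i,j,1,1)\to M_2(k)$; equivalently, there exist $2\times2$ matrices $x,y\in M_2(k)$ with $x^iy+yx^j=1$ and $y^2=0$. *)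

(* Defs.v *)
From HB Require Import structures.
From mathcomp Require Import all_boot all_order all_algebra.
From mathcomp Require Import generic_quotient ring_quotient.
From mathcomp Require Import boolp.
From mathcomp Require Import monalg.

Set Implicit Arguments.
Unset Strict Implicit.
Unset Printing Implicit Defensive.

Import GRing.Theory Quotient.
Local Open Scope ring_scope.
Local Open Scope quotient_scope.

Section TwoSidedIdeal.
Variables (R : nzRingType) (S : R -> Prop).

Inductive in_ideal_gen : R -> Prop :=
| IdealGen u of S u : in_ideal_gen u
| Ideal0 : in_ideal_gen 0
| IdealB u v of in_ideal_gen u & in_ideal_gen v : in_ideal_gen (u - v)
| IdealMl a u of in_ideal_gen u : in_ideal_gen (a * u)
| IdealMr u a of in_ideal_gen u : in_ideal_gen (u * a).

(* Classically decided, as quotients in generic_quotient need boolean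
   relations. *)
Definition ideal_gen : {pred R} := fun u => `[< in_ideal_gen u >].

Lemma ideal_genP u : reflect (in_ideal_gen u) (u \in ideal_gen).
Proof. exact: asboolP. Qed.

Fact ideal_gen_zmod_closed : zmod_closed ideal_gen.
Proof.
split=> [|u v /ideal_genP Iu /ideal_genP Iv]; apply/ideal_genP.
  exact: Ideal0.
exact: IdealB.
Qed.

HB.instance Definition _ :=
  GRing.isZmodClosed.Build R ideal_gen ideal_gen_zmod_closed.

(* The library only gives {quot I} a ring structure when the ambient ring is
   commutative and I is proper; here R is noncommutative and the quotient may
   be the zero ring. *)
Definition quot_gen := quot ideal_gen.

HB.instance Definition _ := GRing.Zmodule.on quot_gen.
HB.instance Definition _ : EqQuotient R (equiv ideal_gen) quot_gen :=
  EqQuotient.on quot_gen.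

Definition quot_gen_one : quot_gen := \pi_quot_gen 1.
Definition quot_gen_mul := lift_op2 quot_gen *%R.

Lemma quot_gen_eqP (u v : R) :
  \pi_quot_gen u = \pi_quot_gen v <-> in_ideal_gen (u - v).
Proof.
split=> [/eqP|/ideal_genP Iuv]; first by rewrite -idealrBE => /ideal_genP.
by apply/eqP; rewrite -idealrBE.
Qed.

Lemma pi_quot_genB (u v : R) :
  \pi_quot_gen (u - v) = \pi_quot_gen u - \pi_quot_gen v.
Proof. exact: (raddfB (\pi_(quot ideal_gen))). Qed.

Lemma pi_quot_genD (u v : R) :
  \pi_quot_gen (u + v) = \pi_quot_gen u + \pi_quot_gen v.
Proof. exact: (raddfD (\pi_(quot ideal_gen))). Qed.

Lemma pi_quot_genM (u v : R) :
  \pi_quot_gen (u * v) = quot_gen_mul (\pi_quot_gen u) (\pi_quot_gen v).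
Proof.
unlock quot_gen_mul; apply/quot_gen_eqP.
set u' := repr _; set v' := repr _.
have Iu : in_ideal_gen (u - u') by apply/quot_gen_eqP; rewrite reprK.
have Iv : in_ideal_gen (v' - v) by apply/quot_gen_eqP; rewrite reprK.
have -> : u * v - u' * v' = (u - u') * v - u' * (v' - v).
  by rewrite mulrBl mulrBr opprB addrA subrK.
by apply: IdealB; [apply: IdealMr | apply: IdealMl].
Qed.

Fact quot_gen_mulA : associative quot_gen_mul.
Proof.
move=> u v w; rewrite -[u]reprK -[v]reprK -[w]reprK.
by rewrite -!pi_quot_genM mulrA.
Qed.

Fact quot_gen_mul1 : left_id quot_gen_one quot_gen_mul.
Proof. by move=> u; rewrite -[u]reprK -pi_quot_genM mul1r. Qed.

Fact quot_gen_mulr1 : right_id quot_gen_one quot_gen_mul.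
Proof. by move=> u; rewrite -[u]reprK -pi_quot_genM mulr1. Qed.

Fact quot_gen_mulDl : left_distributive quot_gen_mul +%R.
Proof.
move=> u v w; rewrite -[u]reprK -[v]reprK -[w]reprK.
by rewrite -!pi_quot_genM -!pi_quot_genD -pi_quot_genM mulrDl.
Qed.

Fact quot_gen_mulDr : right_distributive quot_gen_mul +%R.
Proof.
move=> u v w; rewrite -[u]reprK -[v]reprK -[w]reprK.
by rewrite -!pi_quot_genM -!pi_quot_genD -pi_quot_genM mulrDr.
Qed.

HB.instance Definition _ := GRing.Zmodule_isPzRing.Build quot_gen
  quot_gen_mulA quot_gen_mul1 quot_gen_mulr1 quot_gen_mulDl quot_gen_mulDr.

End TwoSidedIdeal.

(* The free algebra on two generators, as the monoid algebra of the free
   monoid on bool. *)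
Definition free_alg2 (A : comNzRingType) : nzRingType := {malg A[{fmonom bool}]}.

Definition Xgen (A : comNzRingType) : free_alg2 A := << fmu false >>.
Definition Ygen (A : comNzRingType) : free_alg2 A := << fmu true >>.

Definition relators (A : comNzRingType) (i j : nat) (u : free_alg2 A) : Prop :=
  u = Xgen A ^+ i * Ygen A + Ygen A * Xgen A ^+ j - 1 \/ u = Ygen A ^+ 2.

(* R(A; i, j, 1, 1) *)
Definition Ralg (A : comNzRingType) (i j : nat) : pzRingType :=
  quot_gen (@relators A i j).

(* (i, j, 1, 1) \in A_k *)
Definition in_calA (k : fieldType) (i j : nat) : Prop :=
  exists f : {rmorphism Ralg k i j -> 'M[k]_2}, exists r, f r != 0.

(* Main.v *)
Require Import Defs.
From HB Require Import structures.
From mathcomp Require Import all_boot all_order all_algebra.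
From mathcomp Require Import all_field generic_quotient monalg.
From mathcomp Require Import ring zify.

(** The universal properties of the free algebra and of the quotient turn a
    homomorphism R(k; i, j, 1, 1) -> M_2(k) into a pair of matrices x, y with
    x^i y + y x^j = 1 and y^2 = 0 ([in_calAP]).

    Write t and d for the trace and determinant of x, and U_n for the Lucas
    sequence U_0 = 0, U_1 = 1, U_{n+2} = t U_{n+1} - d U_n.  By
    Cayley-Hamilton, x^n = U_n x - d U_{n-1}.  As y has trace 0,
    xy + yx = t y + tr(xy), and hence y x y = tr(xy) y.  Multiplying the
    relation by y on either side gives U_i tr(xy) = U_j tr(xy) = 1, and what
    remains of the relation is U_{i+1} = d U_{j-1}.  Conversely any t, d with
    U_i = U_j <> 0 and U_{i+1} = d U_{j-1} come from a solution in which y is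
    the matrix unit E_12, so the matrices disappear from the problem
    ([matrix_solution_lucas]).

    Let a, b be the complex roots of X^2 - t X + d.  The Lucas conditions
    imply a^i = - b^j and a^j = - b^i, while a^n - b^n = U_n (a - b).  If
    a = b, they force i = j = 1.  Suppose that a <> b, so that a^i <> b^i.
    - If i = j, then z = a / b satisfies z^i = -1.
    - If i <> j, then raising to powers once more shows that a and b are roots
      of unity.  The rational root of unity ab is 1 or -1; in the second case
      b = - a ([root_unity_skew]), which makes i and j odd; in the first case
      b is the inverse of a.
    In the two cases that are left, z (respectively z = a) is a root of unity
    such that z + z^-1 is rational.  That number is an algebraic integer, hence
    one of -2, -1, 0, 1, 2, and so z^4 = 1 or z^6 = 1
    ([root_unity_rat_trace]).  The congruences on i and j follow by reducing
    exponents modulo 4 and 6.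

    In the other direction (t, d) = (0, -1), (2, 2) and (1, 1) solve the Lucas
    conditions in the cases (b), (a) with i even, and (c)
    ([admissible_lucas]). *)

Set Implicit Arguments.
Unset Strict Implicit.
Unset Printing Implicit Defensive.

Import Order.TTheory GRing.Theory Num.Theory.
Local Open Scope ring_scope.

(** * Homomorphisms out of a quotient by generators *)

Section QuotGen.
Local Open Scope quotient_scope.
Variables (R : nzRingType) (S : R -> Prop).

Definition quot_proj (u : R) : quot_gen S := \pi_(quot_gen S) u.

Fact quot_proj_is_additive : zmod_morphism quot_proj.
Proof. exact: pi_quot_genB. Qed.

Fact quot_proj_is_multiplicative : monoid_morphism quot_proj.
Proof. by split=> // u v; apply: pi_quot_genM. Qed.

HB.instance Definition _ :=
  GRing.isZmodMorphism.Build R (quot_gen S) quot_proj quot_proj_is_additive.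
HB.instance Definition _ :=
  GRing.isMonoidMorphism.Build R (quot_gen S) quot_proj
    quot_proj_is_multiplicative.

Lemma quot_proj_rel u : S u -> quot_proj u = 0.
Proof.
move=> Su; rewrite -(rmorph0 quot_proj).
by apply/quot_gen_eqP; rewrite subr0; apply: IdealGen.
Qed.

Variables (T : nzRingType) (f : {rmorphism R -> T}).
Hypothesis fS : forall u, S u -> f u = 0.

Lemma rmorph_ideal_gen0 u : in_ideal_gen S u -> f u = 0.
Proof.
elim=> {u} [u /fS // | | u v _ fu _ fv | a u _ fu | u a _ fu].
- exact: rmorph0.
- by rewrite rmorphB fu fv subrr.
- by rewrite rmorphM fu mulr0.
- by rewrite rmorphM fu mul0r.
Qed.

Definition quot_lift (u : quot_gen S) : T := f (repr u).

Lemma quot_lift_proj u : quot_lift (quot_proj u) = f u.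
Proof.
apply/subr0_eq; rewrite -rmorphB; apply: rmorph_ideal_gen0.
by apply/quot_gen_eqP; rewrite reprK.
Qed.

Lemma quot_proj_repr (u : quot_gen S) : quot_proj (repr u) = u.
Proof. exact: reprK. Qed.

Fact quot_lift_is_additive : zmod_morphism quot_lift.
Proof.
move=> u v; rewrite -[u]quot_proj_repr -[v]quot_proj_repr -rmorphB.
by rewrite !quot_lift_proj rmorphB.
Qed.

Fact quot_lift_is_multiplicative : monoid_morphism quot_lift.
Proof.
split=> [|u v]; first by rewrite -(rmorph1 quot_proj) quot_lift_proj rmorph1.
rewrite -[u]quot_proj_repr -[v]quot_proj_repr -rmorphM.
by rewrite !quot_lift_proj rmorphM.
Qed.

(** The universal property of the quotient: f descends because it kills the
    ideal as soon as it kills the generators. *)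
Lemma quot_gen_rmorph :
  exists g : {rmorphism quot_gen S -> T}, forall u, g (quot_proj u) = f u.
Proof.
pose gM := GRing.isZmodMorphism.Build _ _ quot_lift quot_lift_is_additive.
pose gR :=
  GRing.isMonoidMorphism.Build _ _ quot_lift quot_lift_is_multiplicative.
pose g : {rmorphism quot_gen S -> T} := HB.pack quot_lift gM gR.
by exists g; apply: quot_lift_proj.
Qed.

End QuotGen.

(** * Evaluation of the free algebra at two matrices *)

Section FreeAlg.
Variables (A : comNzRingType) (n : nat) (x y : 'M[A]_n.+1).

Definition word_eval (w : {fmonom bool}) : 'M[A]_n.+1 :=
  \prod_(b <- (w : seq bool)) (if b then y else x).

Fact word_eval_is_mmorphism : mmorphism word_eval.
Proof.
split=> [v w|]; first by rewrite /word_eval fmM big_cat.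
by rewrite /word_eval fm1 big_nil.
Qed.

HB.instance Definition _ :=
  isMultiplicative.Build _ _ word_eval word_eval_is_mmorphism.

Definition free_eval : free_alg2 A -> 'M[A]_n.+1 :=
  mmap (@scalar_mx A n.+1) word_eval.

HB.instance Definition _ := GRing.Additive.on free_eval.

Fact free_eval_is_multiplicative : monoid_morphism free_eval.
Proof.
(* Scalar matrices are central, so the general evaluation criterion, which
   asks coefficients to commute with values of words, applies. *)
have := @commr_mmap_is_multiplicative _ _ _ (@scalar_mx A n.+1) word_eval.
by case=> [g m m'|fM f1]; [exact/esym/scalar_mxC | split].
Qed.

HB.instance Definition _ :=
  GRing.isMonoidMorphism.Build _ _ free_eval free_eval_is_multiplicative.

Lemma free_evalX : free_eval (Xgen A) = x.
Proof. by rewrite /free_eval mmapU mul1r /word_eval fmU big_seq1. Qed.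

Lemma free_evalY : free_eval (Ygen A) = y.
Proof. by rewrite /free_eval mmapU mul1r /word_eval fmU big_seq1. Qed.

End FreeAlg.

(** Both universal properties at once; a unital homomorphism to matrices is
    nontrivial because it maps 1 to 1 <> 0. *)
Lemma in_calAP (k : fieldType) i j :
  in_calA k i j <->
  exists x y : 'M[k]_2, x ^+ i * y + y * x ^+ j = 1 /\ y ^+ 2 = 0.
Proof.
split=> [[f _] | [x [y [xy1 y2]]]].
  pose g : {rmorphism free_alg2 k -> 'M[k]_2} :=
    f \o quot_proj (@relators k i j).
  have g0 u : relators i j u -> g u = 0.
    by move=> Su; rewrite /= quot_proj_rel ?rmorph0.
  exists (g (Xgen k)), (g (Ygen k)); split.
    apply/subr0_eq; rewrite -!rmorphXn -!rmorphM -!rmorphD -[1](rmorph1 g).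
    by rewrite -rmorphB; apply: g0; left.
  by rewrite -rmorphXn; apply: g0; right.
case: (@quot_gen_rmorph _ (@relators k i j) _ (free_eval x y)) => [u|g _].
  case=> ->; last by rewrite rmorphXn /= free_evalY.
  by rewrite rmorphB rmorphD !rmorphM !rmorphXn rmorph1 /= free_evalX free_evalY
             xy1 subrr.
by exists g, 1; rewrite rmorph1 oner_neq0.
Qed.

(** * Lucas sequences *)

Section Lucas.
Variable A : comNzRingType.
Implicit Types (t d a b : A).

(** The Lucas sequence of the first kind U_n(t, d). *)
Fixpoint lucas t d n : A :=
  if n is n'.+1 then
    if n' is n''.+1 then t * lucas t d n' - d * lucas t d n'' else 1
  else 0.

Lemma lucas0 t d : lucas t d 0 = 0. Proof. by []. Qed.
Lemma lucas1 t d : lucas t d 1 = 1. Proof. by []. Qed.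
Lemma lucasSS t d n : lucas t d n.+2 = t * lucas t d n.+1 - d * lucas t d n.
Proof. by []. Qed.

(** This covers both the powers of a matrix, by Cayley-Hamilton, and the powers
    of an eigenvalue. *)
Lemma lucas_expr (V : lalgType A) t d (x : V) n : x ^+ 2 = t *: x - d%:A ->
  x ^+ n.+1 = lucas t d n.+1 *: x - (d * lucas t d n)%:A.
Proof.
move=> x2; elim: n => [|n IHn].
  by rewrite lucas0 lucas1 mulr0 !scale0r scale1r subr0.
rewrite exprSr IHn lucasSS mulrBl -!scalerAl mul1r -expr2 x2.
rewrite scalerBr !scalerA scalerBl addrAC ![_ * lucas _ _ n.+1]mulrC.
by rewrite mulrC.
Qed.

(** If X^2 - t X + d has a double root a, then U_n is n a^(n-1); the extra
    factor a avoids the predecessor. *)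
Lemma lucas_double a n : lucas (a + a) (a * a) n * a = n%:R * a ^+ n.
Proof.
suff: lucas (a + a) (a * a) n * a = n%:R * a ^+ n /\
      lucas (a + a) (a * a) n.+1 * a = n.+1%:R * a ^+ n.+1 by case.
elim: n => [|n [IH0 IH1]]; first by rewrite lucas0 lucas1 expr1; split; ring.
split=> //; rewrite lucasSS mulrBl -!mulrA IH0 IH1 !exprS -[n.+2]addn2 natrD.
rewrite -[n.+1]addn1 natrD; ring.
Qed.

End Lucas.

Arguments lucas : simpl never.

Lemma rmorph_lucas (A B : comNzRingType) (f : {rmorphism A -> B}) t d n :
  f (lucas t d n) = lucas (f t) (f d) n.
Proof.
suff: f (lucas t d n) = lucas (f t) (f d) n /\
      f (lucas t d n.+1) = lucas (f t) (f d) n.+1 by case.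
elim: n => [|n [IH0 IH1]]; first by rewrite !lucas0 !lucas1 rmorph0 rmorph1.
by split=> //; rewrite !lucasSS rmorphB !rmorphM IH0 IH1.
Qed.

Lemma lucas_root (A : comNzRingType) (a b : A) n :
  a ^+ n.+1 = lucas (a + b) (a * b) n.+1 * a - a * b * lucas (a + b) (a * b) n.
Proof.
rewrite -[RHS]/(_ *: (a : A^o) - _) -[_ * lucas _ _ n]mulr1.
by apply: (@lucas_expr _ A^o); rewrite -[_%:A]/(_ * _) -[_ *: _]/(_ * _); ring.
Qed.

(** Once U_m = 0, the sequence restarts at m scaled by U_{m+1}. *)
Lemma lucas_divn_eq (A : comNzRingType) (t d c : A) m n :
  lucas t d m = 0 -> lucas t d m.+1 = c ->
  lucas t d n = c ^+ (n %/ m) * lucas t d (n %% m).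
Proof.
move=> Um Um1.
have shift k : lucas t d (k + m) = c * lucas t d k.
  suff: lucas t d (k + m) = c * lucas t d k /\
        lucas t d (k + m).+1 = c * lucas t d k.+1 by case.
  elim: k => [|k [IH0 IH1]]; first by rewrite lucas0 lucas1 mulr0 mulr1.
  by split; rewrite addSn // !lucasSS IH0 IH1; ring.
rewrite [in LHS](divn_eq n m); elim: (n %/ m)%N => [|q IHq].
  by rewrite mul0n add0n mul1r.
by rewrite mulSn -addnA addnC shift IHq exprS mulrA.
Qed.

(** * Reduction from matrices to Lucas sequences *)

Section Matrix22.
Variable A : comNzRingType.
Implicit Types x y : 'M[A]_2.

Lemma matrix22P x y :
  [/\ x 0 0 = y 0 0, x 0 1 = y 0 1, x 1 0 = y 1 0 & x 1 1 = y 1 1] -> x = y.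
Proof.
case=> e00 e01 e10 e11.
have ord2 (r : 'I_2) : r = 0 \/ r = 1.
  by case: r => -[|[|//]] lt_r; [left | right]; apply: val_inj.
by apply/matrixP=> r s; case: (ord2 r) => ->; case: (ord2 s) => ->.
Qed.

Lemma sum22 (F : 'I_2 -> A) : \sum_i F i = F 0 + F 1.
Proof.
rewrite big_ord_recl big_ord1; congr (F _ + F _); exact: val_inj.
Qed.

Lemma mxtrace22 x : \tr x = x 0 0 + x 1 1.
Proof. exact: sum22. Qed.

Lemma mulmx22 x y r s : (x * y) r s = x r 0 * y 0 s + x r 1 * y 1 s.
Proof. by rewrite mxE sum22. Qed.

Lemma det22 x : \det x = x 0 0 * x 1 1 - x 0 1 * x 1 0.
Proof.
rewrite (expand_det_row x 0) sum22 /cofactor !det_mx11 !mxE /=.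
rewrite expr0 expr1 mul1r mulN1r mulrN.
by congr (_ * x _ _ - _ * x _ _); apply: val_inj.
Qed.

Lemma Cayley_Hamilton22 x : x ^+ 2 = \tr x *: x - (\det x)%:A.
Proof.
by apply/matrix22P; split;
  rewrite expr2 mulmx22 mxtrace22 det22 !mxE /=; ring.
Qed.

(** The polarization of Cayley-Hamilton: apply it to x + y, x and y, and
    subtract. *)
Lemma anticomm22 x y : x * y + y * x =
  \tr x *: y + \tr y *: x + (\tr (x * y) - \tr x * \tr y)%:A.
Proof.
apply/matrix22P; split;
  rewrite [LHS]mxE !mxtrace22 !mulmx22 !mxE /=; ring.
Qed.

End Matrix22.

Section Reduction.
Variable F : fieldType.
Implicit Types (x y : 'M[F]_2) (t d : F).

Lemma sqr0_mxtrace y : y ^+ 2 = 0 -> \tr y = 0.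
Proof.
move=> y2; have dy : \det y = 0.
  apply/eqP; rewrite -[_ == 0]orbb -mulf_eq0 -det_mulmx -[_ *m _]/(y * y).
  by rewrite -expr2 y2 det0.
have := Cayley_Hamilton22 y; rewrite y2 dy scale0r subr0 => /esym/eqP.
by rewrite scaler_eq0 => /orP[/eqP // | /eqP ->]; rewrite mxtrace0.
Qed.

(** The exponents are i.+1 and j.+1, so that the term U_{j-1} which the powers of
    x produce is indexed by a natural number.  Multiplying the relation by y on
    either side isolates U_i and U_j, because y x y = tr(xy) y. *)
Lemma matrix_solution_lucas i j :
  (exists x y, x ^+ i.+1 * y + y * x ^+ j.+1 = 1 /\ y ^+ 2 = 0) <->
  exists t d, [/\ lucas t d i.+1 != 0, lucas t d i.+1 = lucas t d j.+1
                & lucas t d i.+2 = d * lucas t d j].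
Proof.
split=> [[x [y [xy1 y2]]] | [t [d [u0 uij uE]]]].
  have y0 : y != 0.
    apply/eqP=> y0; move/eqP: xy1.
    by rewrite y0 mulr0 mul0r addr0 eq_sym oner_eq0.
  have tr0 := sqr0_mxtrace y2.
  exists (\tr x), (\det x); set t := \tr x; set d := \det x.
  have xn n : x ^+ n.+1 = lucas t d n.+1 *: x - (d * lucas t d n)%:A.
    exact/lucas_expr/Cayley_Hamilton22.
  have yy : y * y = 0 by rewrite -expr2.
  set s := \tr (x * y).
  have acomm : x * y + y * x = t *: y + s%:A.
    by rewrite anticomm22 tr0 scale0r addr0 mulr0 subr0.
  have yxy : y * x * y = s *: y.
    have := congr1 ( *%R y) acomm.
    rewrite !mulrDr !mulrA yy mul0r addr0 -!scalerAr yy scaler0 mulr1.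
    by rewrite add0r.
  have cancel_y u : (u * s) *: y = y -> u * s = 1.
    rewrite -[RHS]scale1r => /eqP; rewrite -subr_eq0 -scalerBl scaler_eq0.
    by rewrite (negbTE y0) orbF subr_eq0 => /eqP.
  move: xy1; rewrite !xn mulrBl mulrBr -!scalerAl -!scalerAr mul1r mulr1 => E.
  have uis : lucas t d i.+1 * s = 1.
    apply: cancel_y; have := congr1 ( *%R y) E.
    rewrite !mulrDr !mulrN -!scalerAr !mulrA yy mul0r !scaler0 !subr0 addr0.
    by rewrite yxy mulr1 scalerA.
  have ujs : lucas t d j.+1 * s = 1.
    apply: cancel_y; have := congr1 ( *%R^~ y) E.
    rewrite /= !mulrDl !mulNr -!scalerAl -!mulrA yy mulr0 !scaler0 !subr0.
    by rewrite add0r mulrA yxy mul1r scalerA.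
  have /andP[u0 s0] : (lucas t d i.+1 != 0) && (s != 0).
    by rewrite -negb_or -mulf_eq0 uis oner_eq0.
  have uij : lucas t d i.+1 = lucas t d j.+1.
    by apply: (mulIf s0); rewrite uis.
  split=> //.
  (* The scalar part of the relation is already accounted for by u s = 1; the
     rest is a multiple of y, whose coefficient must vanish. *)
  move: E; rewrite -uij addrACA -scalerDr acomm scalerDr !scalerA uis -addrA.
  rewrite -opprD -scalerDl scale1r addrCA -scalerBl => /eqP.
  rewrite -subr_eq0 addrAC subrr add0r scaler_eq0 (negbTE y0) orbF => /eqP E.
  apply/subr0_eq; rewrite -E lucasSS; ring.
(* With y = E_12 the relation asks that the lower left entries of x^i and x^j
   be 1, hence that the one of x be 1 / U_i; a zero in the corner then leaves
   no choice for a matrix of trace t and determinant d. *)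
exists (\matrix_(r, s)
  if r == 0 then (if s == 0 then 0 else - d * lucas t d i.+1)
  else (if s == 0 then (lucas t d i.+1)^-1 else t)).
exists (delta_mx 0 1).
set x := \matrix_(_, _) _; set y := delta_mx _ _.
have x2 : x ^+ 2 = t *: x - d%:A.
  by apply/matrix22P; split; rewrite expr2 mulmx22 !mxE /=; field.
split; last first.
  by apply/matrix22P; split; rewrite expr2 mulmx22 !mxE /=; ring.
rewrite !(lucas_expr _ x2) -uij /x.
move: uE u0; rewrite lucasSS.
move: (lucas t d i.+1) (lucas t d i) (lucas t d j) => u v w /eqP.
rewrite -subr_eq0 => /eqP uvw u0.
apply/matrix22P; split; rewrite [LHS]mxE !mulmx22 !mxE /=; try by field.
by rewrite -[RHS]uvw; ring.
Qed.

End Reduction.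

(** * Roots of unity of degree at most two *)

Section RootsOfUnity.
Implicit Types a b z : algC.

Lemma expr1_Aint z n : (0 < n)%N -> z ^+ n = 1 -> z \in Aint.
Proof. by move=> n0 zn; apply: (Aint_unity_root n0); apply/unity_rootP. Qed.

Lemma expr1_neq0 z n : (0 < n)%N -> z ^+ n = 1 -> z != 0.
Proof.
move=> n0 zn; apply/eqP=> z0; move/eqP: zn.
by rewrite z0 expr0n gtn_eqF // eq_sym oner_eq0.
Qed.

Lemma expr1_norm z n : (0 < n)%N -> z ^+ n = 1 -> `|z| = 1.
Proof.
move=> n0 /(congr1 Num.norm); rewrite normrX normr1 => /eqP.
by rewrite pexpr_eq1 ?normr_ge0 // => /eqP.
Qed.

(** A rational algebraic integer is an integer, and z + z^-1 has absolute value
    at most 2; the five possible values give z of order 1, 2, 3, 4 or 6. *)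
Lemma root_unity_rat_trace z n : (0 < n)%N -> z ^+ n = 1 ->
  z + z^-1 \in Crat -> z ^+ 4 = 1 \/ z ^+ 6 = 1.
Proof.
move=> n0 zn Qs; have z0 := expr1_neq0 n0 zn.
have Vzn : z^-1 ^+ n = 1 by rewrite exprVn zn invr1.
have /intrP[m sm] : z + z^-1 \in Num.int.
  by apply: Cint_rat_Aint => //; rewrite rpredD // (expr1_Aint n0).
have le_m2 : (`|m| <= 2)%R.
  rewrite -(ler_int algC) intr_norm -sm (le_trans (ler_normD _ _)) //.
  by rewrite (expr1_norm n0 zn) (expr1_norm n0 Vzn).
have z2 : z ^+ 2 = m%:~R * z - 1.
  by rewrite -sm mulrDl mulVf // addrK.
have sqr0_eq w : (z - w) ^+ 2 = 0 -> z = w.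
  by move=> /eqP; rewrite expf_eq0 /= => /eqP/subr0_eq.
have z6 : m ^+ 2 = 1 -> z ^+ 6 = 1.
  move=> /(congr1 (intr : int -> algC)); rewrite rmorphXn rmorph1 /= => m2.
  have z3 : z ^+ 3 = - m%:~R.
    by rewrite exprS z2 mulrBr mulrCA -expr2 z2 mulrBr mulrA -expr2 m2; ring.
  by rewrite -[6%N]/(3 * 2)%N exprM z3 sqrrN.
have : m \in [:: -2; -1; 0; 1; 2] by rewrite !inE; lia.
rewrite !inE => /or4P[/eqP e | /eqP e | /eqP e | /orP[/eqP e | /eqP e]].
- left; rewrite (sqr0_eq (-1)); first by ring.
  by rewrite sqrrB z2 e; ring.
- by right; apply: z6; rewrite e.
- by left; rewrite -[4%N]/(2 * 2)%N exprM z2 e; ring.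
- by right; apply: z6; rewrite e.
- left; rewrite (sqr0_eq 1) ?expr1n //.
  by rewrite sqrrB z2 e; ring.
Qed.

(** Conjugation inverts a root of unity, so it negates a + b = a - a^-1; being
    rational, this number is 0. *)
Lemma root_unity_skew a b n : (0 < n)%N -> a ^+ n = 1 -> a * b = -1 ->
  a + b \in Crat -> b = - a.
Proof.
move=> n0 an ab Qt; have a0 := expr1_neq0 n0 an.
have bE : b = - a^-1 by apply: (mulfI a0); rewrite ab mulrN divff.
have := conj_Crat Qt.
have ca : Num.conj a = a^-1.
  by rewrite invC_norm (expr1_norm n0 an) expr1n invr1 mul1r.
rewrite bE rmorphD rmorphN rmorphV ?unitfE //= ca invrK addrC => E.
have : (a - a^-1) *+ 2 = 0 by rewrite mulr2n -{1}E; ring.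
by move/eqP; rewrite mulrn_eq0 /= subr_eq0 => /eqP <-.
Qed.

End RootsOfUnity.

(** * The congruences forced by the eigenvalues *)

Definition admissible (i j : nat) : Prop :=
  [\/ i = j /\ i <> 0 %[mod 4],
      i = 1 %[mod 2] /\ j = 1 %[mod 2]
    | [\/ i = 1 %[mod 6] /\ j = 2 %[mod 6],
          i = 2 %[mod 6] /\ j = 1 %[mod 6],
          i = 4 %[mod 6] /\ j = 5 %[mod 6]
        | i = 5 %[mod 6] /\ j = 4 %[mod 6]]].

Lemma admissible_odd i j : odd i -> odd j -> admissible i j.
Proof. by move=> oi oj; apply: Or32; rewrite !modn2 oi oj. Qed.

Lemma expr1_dvd (R : pzRingType) (z : R) n m :
  z ^+ n = 1 -> (n %| m)%N -> z ^+ m = 1.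
Proof. by move=> zn /dvdnP[q ->]; rewrite mulnC exprM zn expr1n. Qed.

(** Eliminating b from the two equations leaves a^(i^2) = +- a^(j^2); the factor
    2 in the exponents below absorbs the sign. *)
Lemma cross_root_unity i j (a b : algC) : i != j -> a != 0 ->
  a ^+ i = - b ^+ j -> a ^+ j = - b ^+ i ->
  exists2 n, (0 < n)%N & a ^+ n = 1.
Proof.
move=> ij a0 aibj ajbi.
have N2 (c : algC) n : (- c) ^+ n ^+ 2 = c ^+ n ^+ 2.
  by rewrite exprAC sqrrN exprAC.
have E : a ^+ (i * i * 2) = a ^+ (j * j * 2).
  by rewrite [LHS]exprM [RHS]exprM [a ^+ (i * i)]exprM [a ^+ (j * j)]exprM
             aibj ajbi !N2 [b ^+ j ^+ i]exprAC.
have sq_ne : (i * i * 2 != j * j * 2)%N by apply: contraNneq ij; nia.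
have ltE m n : (m < n)%N -> a ^+ m = a ^+ n -> a ^+ (n - m) = 1.
  move=> /ltnW mn amn; apply: (mulfI (expf_neq0 m a0)).
  by rewrite -exprD subnKC // mulr1.
have [lt_ij | lt_ji | /eqP] := ltngtP (i * i * 2)%N (j * j * 2)%N.
- by exists (j * j * 2 - i * i * 2)%N; [rewrite subn_gt0 | apply: ltE].
- by exists (i * i * 2 - j * j * 2)%N; [rewrite subn_gt0 | apply: ltE].
- by rewrite (negbTE sq_ne).
Qed.

(** The case where the eigenvalues are a and a^-1.  If a^4 = 1, then i and j are
    odd.  If a^6 = 1, the conditions say that 3 divides i + j but neither i nor
    j, and that i + j is odd. *)
Lemma admissible_inv i j (a : algC) : (exists2 n, (0 < n)%N & a ^+ n = 1) ->
  a + a^-1 \in Crat ->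
  a ^+ (i + j) = -1 -> a ^+ (2 * i) != 1 -> a ^+ (2 * j) != 1 ->
  admissible i j.
Proof.
move=> [n n0 an] Qs aij a2i a2j.
have N1 : -1 != 1 :> algC by rewrite eqNr oner_eq0.
have [a4|a6] := root_unity_rat_trace n0 an Qs.
  apply: admissible_odd.
    by apply: contraNT a2i => ?; apply/eqP/(expr1_dvd a4); lia.
  by apply: contraNT a2j => ?; apply/eqP/(expr1_dvd a4); lia.
have ni : ~~ (3 %| i)%N.
  by apply: contraNN a2i => ?; apply/eqP/(expr1_dvd a6); lia.
have nj : ~~ (3 %| j)%N.
  by apply: contraNN a2j => ?; apply/eqP/(expr1_dvd a6); lia.
have s3 : (3 %| i + j)%N.
  apply: contraNT a2i => ns.
  have -> : a ^+ (2 * i) = a ^+ (2 * i + (i + j) * 2).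
    by rewrite exprD exprM [a ^+ (_ * 2)]exprM aij sqrrN !expr1n mulr1 -exprM.
  by apply/eqP/(expr1_dvd a6); lia.
have [oij | eij] := boolP (odd (i + j)); last first.
  case/eqP: N1; rewrite -aij; apply: (expr1_dvd a6); lia.
apply: Or33.
have : [|| (i %% 6 == 1) && (j %% 6 == 2), (i %% 6 == 2) && (j %% 6 == 1),
  (i %% 6 == 4) && (j %% 6 == 5) | (i %% 6 == 5) && (j %% 6 == 4)]%N by lia.
case/or4P=> /andP[/eqP-> /eqP->];
  [exact: Or41 | exact: Or42 | exact: Or43 | exact: Or44].
Qed.

(** When i = j, the quotient a / b and its inverse have the rational sum
    ((a + b)^2 - 2 a b) / (a b).  When i <> j, the rational root of unity a b is
    1 or -1. *)
Lemma distinct_eigenvalues_admissible i j (a b : algC) :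
  (0 < i)%N -> (0 < j)%N ->
  a + b \in Crat -> a * b \in Crat ->
  a ^+ i = - b ^+ j -> a ^+ j = - b ^+ i ->
  a ^+ i != b ^+ i -> a ^+ j != b ^+ j -> admissible i j.
Proof.
move=> i0 j0 Qs Qp aibj ajbi ni nj.
have b_a : b = 0 -> a = 0.
  move=> b0; move/eqP: aibj; rewrite b0 expr0n gtn_eqF // oppr0 expf_eq0.
  by case/andP=> _ /eqP.
have a0 : a != 0.
  apply: contraNneq ni => a0; move/eqP: aibj.
  rewrite a0 !expr0n gtn_eqF // eq_sym oppr_eq0 expf_eq0 => /andP[_ /eqP ->].
  by rewrite expr0n gtn_eqF.
have b0 : b != 0 by apply: contraNneq a0 => /b_a ->.
have [eij | nij] := eqVneq i j.
  apply: Or31; split=> //; rewrite mod0n => i4.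
  set z := a / b.
  have zi : z ^+ i = -1.
    by rewrite /z expr_div_n aibj -eij mulNr divff // expf_neq0.
  have Qz : z + z^-1 \in Crat.
    have -> : z + z^-1 = ((a + b) ^+ 2 - a * b *+ 2) / (a * b).
      by rewrite /z; field; rewrite a0 b0.
    by rewrite rpred_div // rpredB ?rpredX // rpredMn.
  have z2i : z ^+ (i * 2) = 1 by rewrite exprM zi sqrrN expr1n.
  have N1 : -1 != 1 :> algC by rewrite eqNr oner_eq0.
  have i2_gt0 : (0 < i * 2)%N by rewrite muln_gt0 i0.
  (* If 4 divides i, then 12 divides 3 i, which contradicts z^(3 i) = -1. *)
  have z12 : z ^+ 12 = 1.
    by have [z4|z6] := root_unity_rat_trace i2_gt0 z2i Qz;
      [apply: (expr1_dvd z4) | apply: (expr1_dvd z6)].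
  have : z ^+ (i * 3) = 1 by apply: (expr1_dvd z12); lia.
  by rewrite exprM zi -signr_odd /= expr1 => /eqP; rewrite (negbTE N1).
have [n n0 an] := cross_root_unity nij a0 aibj ajbi.
have [m m0 bm] : exists2 m, (0 < m)%N & b ^+ m = 1.
  by apply: (cross_root_unity nij b0 (b := a)); rewrite ?aibj ?ajbi opprK.
have dnm : (a * b) ^+ (n * m) = 1.
  by rewrite exprMn exprM an [(n * m)%N]mulnC exprM bm !expr1n mulr1.
have nm0 : (0 < n * m)%N by rewrite muln_gt0 n0.
have : a * b = 1 \/ a * b = -1.
  have Zd : a * b \in Num.int by rewrite Cint_rat_Aint // (expr1_Aint nm0).
  have : (a * b) ^+ 2 = 1.
    by rewrite -[LHS]intr_normK // (expr1_norm nm0) // expr1n.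
  by move/eqP; rewrite sqrf_eq1 => /orP[] /eqP; [left | right].
case=> ab.
  have bE : b = a^-1 by apply: (mulfI a0); rewrite ab divff.
  have n2 k : a ^+ k != b ^+ k -> a ^+ (2 * k) != 1.
    apply: contraNneq; rewrite mul2n -addnn exprD bE exprVn => E.
    by apply/eqP/(mulIf (expf_neq0 k a0)); rewrite E mulVf // expf_neq0.
  apply: (@admissible_inv i j a); rewrite ?n2 //; first by exists n.
    by rewrite -bE.
  by rewrite exprD aibj bE mulNr exprVn mulVf // expf_neq0.
have bE := root_unity_skew n0 an ab Qs.
have odd_k k : a ^+ k != b ^+ k -> odd k.
  by apply: contraNT => ek; rewrite bE exprNn -signr_odd (negbTE ek) mul1r.
by apply: admissible_odd; apply: odd_k.
Qed.

Lemma vieta_roots (t d : algC) : exists a b, t = a + b /\ d = a * b.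
Proof.
pose s := sqrtC (t ^+ 2 - 4 * d).
have s2 : s ^+ 2 = t ^+ 2 - 4 * d by rewrite sqrtCK.
exists ((t + s) / 2), ((t - s) / 2); split; first by field.
have -> : (t + s) / 2 * ((t - s) / 2) = (t ^+ 2 - s ^+ 2) / 4 by field.
by rewrite s2; field.
Qed.

Lemma lucas_admissible i j (t d : rat) :
  lucas t d i.+1 != 0 -> lucas t d i.+1 = lucas t d j.+1 ->
  lucas t d i.+2 = d * lucas t d j -> admissible i.+1 j.+1.
Proof.
have [a [b [qt qd]]] := vieta_roots (ratr t) (ratr d).
have qU n : ratr (lucas t d n) = lucas (a + b) (a * b) n.
  by rewrite rmorph_lucas /= qt qd.
move=> u0 /(congr1 (ratr : rat -> algC)) + /(congr1 (ratr : rat -> algC)).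
rewrite rmorphM /= !qU qd => uij uE.
have {}u0 : lucas (a + b) (a * b) i.+1 != 0 by rewrite -qU fmorph_eq0.
(* By lucas_root, both sums are U_i t - d (U_{i-1} + U_{j-1}), that is
   U_{i+1} - d U_{j-1}. *)
have cross : a ^+ i.+1 + b ^+ j.+1 = 0 /\ a ^+ j.+1 + b ^+ i.+1 = 0.
  move: uE; rewrite lucasSS.
  rewrite !(lucas_root a b) ![b ^+ _](lucas_root b a).
  rewrite ![b + a]addrC ![b * a]mulrC.
  rewrite -uij => /eqP; rewrite -subr_eq0 => /eqP uE.
  by split; rewrite -[RHS]uE; ring.
have [aibj ajbi] : a ^+ i.+1 = - b ^+ j.+1 /\ a ^+ j.+1 = - b ^+ i.+1.
  by case: cross => /eqP + /eqP; rewrite !addr_eq0 => /eqP + /eqP.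
have [eab | nab] := eqVneq a b; last first.
  have diff n : a ^+ n.+1 - b ^+ n.+1 = lucas (a + b) (a * b) n.+1 * (a - b).
    rewrite (lucas_root a b) (lucas_root b a) [b + a]addrC [b * a]mulrC.
    by ring.
  apply: (@distinct_eigenvalues_admissible _ _ a b) => //.
  - by rewrite -qt Crat_rat.
  - by rewrite -qd Crat_rat.
  - by rewrite -subr_eq0 diff mulf_neq0 // subr_eq0.
  - by rewrite -subr_eq0 diff mulf_neq0 // -?uij // subr_eq0.
(* With a = b, multiplying U_i = U_j by a gives i a^i = j a^j = - j a^i. *)
move: uij u0 aibj; rewrite -eab => uij u0 aibj.
have a0 : a = 0.
  have := congr1 ( *%R^~ a) uij; rewrite /= !lucas_double aibj mulrN => /eqP.
  rewrite eq_sym -addr_eq0 -mulrDl -natrD mulf_eq0 pnatr_eq0 /=.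
  by rewrite expf_eq0 => /eqP.
have U0 n : lucas (0 : algC) 0 n.+2 = 0 by rewrite lucasSS !mul0r subrr.
move: uij u0; rewrite a0 addr0 mulr0 => uij u0.
case: i u0 uij {qU uE cross aibj ajbi} => [|i]; last by rewrite U0 eqxx.
case: j => [|j]; first by move=> _ _; apply: admissible_odd.
by move=> u0 u; rewrite u U0 eqxx in u0.
Qed.

(** * Rational solutions *)

Lemma admissible_lucas i j : admissible i.+1 j.+1 -> exists t d : rat,
  [/\ lucas t d i.+1 != 0, lucas t d i.+1 = lucas t d j.+1
    & lucas t d i.+2 = d * lucas t d j].
Proof.
(* The eigenvalues 1 and -1 settle the case of odd exponents. *)
have U2 n : lucas 0 (-1) n = lucas 0 (-1) (n %% 2) :> rat.
  by rewrite (@lucas_divn_eq rat 0 (-1) 1 2) // expr1n mul1r.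
have odd_sol : (i.+1 %% 2 = 1)%N -> (j.+1 %% 2 = 1)%N -> exists t d : rat,
  [/\ lucas t d i.+1 != 0, lucas t d i.+1 = lucas t d j.+1
    & lucas t d i.+2 = d * lucas t d j].
  move=> oi oj; exists 0, (-1).
  have [i2 j0] : (i.+2 %% 2 = 0 /\ j %% 2 = 0)%N by lia.
  rewrite [lucas _ _ i.+1]U2 [lucas _ _ j.+1]U2 [lucas _ _ i.+2]U2.
  by rewrite [lucas _ _ j]U2 oi oj i2 j0.
(* With the primitive sixth roots of unity as eigenvalues, U_n has period 6. *)
have U6 n : lucas 1 1 n = lucas 1 1 (n %% 6) :> rat.
  by rewrite (@lucas_divn_eq rat 1 1 1 6) // expr1n mul1r.
(* Modulo 6, l + 5 is l - 1. *)
have sol6 k l : (i.+1 %% 6 = k)%N -> (j.+1 %% 6 = l)%N ->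
  lucas 1 1 k != 0 :> rat -> lucas 1 1 k = lucas 1 1 l :> rat ->
  lucas 1 1 k.+1 = lucas 1 1 (l + 5) :> rat -> exists t d : rat,
  [/\ lucas t d i.+1 != 0, lucas t d i.+1 = lucas t d j.+1
    & lucas t d i.+2 = d * lucas t d j].
  move=> ik jl k0 kl kl'; exists 1, 1.
  have [i2 j0] : (i.+2 %% 6 = k.+1 %% 6 /\ j %% 6 = (l + 5) %% 6)%N by lia.
  rewrite [lucas _ _ i.+1]U6 [lucas _ _ j.+1]U6 [lucas _ _ i.+2]U6.
  rewrite [lucas _ _ j]U6 ik jl i2 j0 -!U6 kl kl' mul1r.
  by split=> //; rewrite -kl.
case=> [[[eij] i4] | [oi oj] | c].
- have [oi | ei] := boolP (odd i.+1).
    by apply: odd_sol; rewrite modn2 -?eij oi.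
  (* The eigenvalues are the complex numbers 1 + 'i and 1 - 'i, whose quotient
     has order 4. *)
  exists 2, 2; rewrite -eij.
  have U4 n : lucas 2 2 n = (-4) ^+ (n %/ 4) * lucas 2 2 (n %% 4) :> rat.
    exact: lucas_divn_eq.
  rewrite [lucas _ _ i.+1]U4 [lucas _ _ i.+2]U4 [lucas _ _ i]U4.
  have [[-> ->] ->] :
    ((i.+1 %% 4 = 2 /\ i.+2 %% 4 = 3) /\ i %% 4 = 1)%N by lia.
  have [-> ->] : (i.+2 %/ 4 = i %/ 4 /\ i.+1 %/ 4 = i %/ 4)%N by lia.
  split=> //; first by rewrite mulf_neq0 // expf_neq0.
  by rewrite mulrCA.
- exact: odd_sol.
- by case: c => -[ci cj]; apply: (sol6 _ _ ci cj).
Qed.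

Theorem theorem3p8 (i j : nat) (hi : (0 < i)%N) (hj : (0 < j)%N) :
  in_calA rat i j <->
  [\/ i = j /\ i <> 0 %[mod 4],
      i = 1 %[mod 2] /\ j = 1 %[mod 2]
    | [\/ i = 1 %[mod 6] /\ j = 2 %[mod 6],
          i = 2 %[mod 6] /\ j = 1 %[mod 6],
          i = 4 %[mod 6] /\ j = 5 %[mod 6]
        | i = 5 %[mod 6] /\ j = 4 %[mod 6]]].
Proof.
case: i hi => // i _; case: j hj => // j _.
apply: (iff_trans (in_calAP _ _ _)).
apply: (iff_trans (matrix_solution_lucas _ _ _)).
split=> [[t [d [u0 uij uE]]] | ]; first exact: lucas_admissible u0 uij uE.
exact: admissible_lucas.
Qed.
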